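(* Let $m\ge5$ and $\omega\in\Omega$. Then $\operatorname{Ax}(\delta_\omega)=\operatorname{St}(\omega)$.
   Context: Let $\Omega=\{1,\dots,m\}$. The Grassmannian geometry $G_2(m)$ has point set $\mathcal P=\binom{\Omega}{2}$ (the point $\{i,j\}$ is written $ij$) and block set $\mathcal B$ consisting of the triples $b_{ijk}=\{ij,ik,jk\}$, one for each $3$-subset $\{i,j,k\}\subseteq\Omega$; $\operatorname{supp}(b_{ijk})=\{i,j,k\}$. A decoration is a map $\delta:\mathcal B\to\{\pm1\}$. For $\omega\in\Omega$, the star decoration $\delta_\omega$ is $\delta_\omega(b)=-1$ if $\omega\in\operatorname{supp}(b)$ and $\delta_\omega(b)=1$ otherwise. For a block $b$ with $\{i,j,k\}=\operatorname{supp}(b)$ put $n^\delta_{-1}(b)=|\{r\in\Omega\setminus\{i,j,k\}:\ \delta(b_{ijk})\delta(b_{ijr})\delta(b_{ikr})\delta(b_{jkr})=-1\}|$. Define $\operatorname{St}(\omega)=\{b\in\mathcal B:\omega\in\operatorname{supp}(b)\}$ and $\operatorname{Ax}(\delta)=\{b\in\mathcal B:n^\delta_{-1}(b)=m-3\}$. *)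

(* Defs.v *)
From HB Require Import structures.
From mathcomp Require Import all_boot all_order all_algebra.
Set Implicit Arguments.
Unset Strict Implicit.
Unset Printing Implicit Defensive.
Import Order.TTheory GRing.Theory Num.Theory.
Local Open Scope ring_scope.

Definition point (m : nat) : finType := {p : {set 'I_m} | #|p| == 2}.

(* b_{ijk}, as a set of points; only meaningful for distinct i, j, k. *)
Definition triple (m : nat) (i j k : 'I_m) : {set point m} :=
  [set p : point m | val p \in [:: [set i; j]; [set i; k]; [set j; k]]].

Definition is_block (m : nat) (b : {set point m}) : bool :=
  [exists i, exists j, exists k,
     [&& i != j, i != k, j != k & b == triple i j k]].

Definition block (m : nat) : finType := {b : {set point m} | is_block b}.

(* See supp_blockP: for b = b_{ijk} the union of the points is {i,j,k}. *)
Definition supp (m : nat) (b : block m) : {set 'I_m} :=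
  \bigcup_(p in val b) val p.

Record decoration (m : nat) := Decoration {
  decoration_fun :> block m -> int;
  decoration_pm1 : forall b, decoration_fun b = 1 \/ decoration_fun b = -1 }.

(* The value of delta at b_{ijk}; the default 1 is only returned when i, j, k
   are not distinct. *)
Definition dec_at (m : nat) (delta : decoration m) (i j k : 'I_m) : int :=
  if insub (triple i j k) is Some b then delta b else 1.

(* The product is symmetric in i, j, k, so every enumeration of supp b gives
   the same truth value; see n_neg1E. *)
Definition n_neg1 (m : nat) (delta : decoration m) (b : block m) : nat :=
  #|[set r : 'I_m | (r \notin supp b) &&
      [exists i, exists j, exists k, (supp b == [set i; j; k]) &&
         (dec_at delta i j k * dec_at delta i j r *
          dec_at delta i k r * dec_at delta j k r == -1)]]|.

Lemma star_fun_pm1 (m : nat) (w : 'I_m) (b : block m) :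
  (if w \in supp b then -1 else 1 : int) = 1 \/
  (if w \in supp b then -1 else 1 : int) = -1.
Proof. by case: ifP; [right | left]. Qed.

Definition star_decoration (m : nat) (w : 'I_m) : decoration m :=
  Decoration (star_fun_pm1 w).

Definition St (m : nat) (w : 'I_m) : {set block m} :=
  [set b | w \in supp b].

Definition Ax (m : nat) (delta : decoration m) : {set block m} :=
  [set b | n_neg1 delta b == (m - 3)%N].

Lemma triple_perm12 (m : nat) (i j k : 'I_m) : triple j i k = triple i j k.
Proof.
by apply/setP=> p; rewrite !inE (setUC [set j] [set i]) [X in _ || X]orbC.
Qed.

Lemma triple_perm23 (m : nat) (i j k : 'I_m) : triple i k j = triple i j k.
Proof.
by apply/setP=> p; rewrite !inE (setUC [set k] [set j]) orbCA.
Qed.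

Lemma triple_is_block (m : nat) (i j k : 'I_m) :
  i != j -> i != k -> j != k -> is_block (triple i j k).
Proof.
move=> ij ik jk; apply/existsP; exists i; apply/existsP; exists j.
by apply/existsP; exists k; rewrite ij ik jk eqxx.
Qed.

Lemma dec_at_block (m : nat) (delta : decoration m) (i j k : 'I_m)
    (b : block m) : val b = triple i j k -> dec_at delta i j k = delta b.
Proof. by rewrite /dec_at => <-; rewrite valK. Qed.

Lemma supp_blockP (m : nat) (i j k : 'I_m) (b : block m) :
  i != j -> i != k -> j != k -> val b = triple i j k ->
  supp b = [set i; j; k].
Proof.
move=> ij ik jk bE; rewrite /supp bE; apply/setP=> x; apply/bigcupP/idP.
  case=> p; rewrite !inE => /or3P[] /eqP->; rewrite !inE;
  by case/orP=> ->; rewrite ?orbT.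
have pt a c : a != c -> #|[set a; c] : {set 'I_m}| == 2.
  by move=> ac; rewrite cards2 ac.
have memb a c : a != c -> x \in [set a; c] ->
    [set a; c] \in [:: [set i; j]; [set i; k]; [set j; k]] ->
    exists2 p, p \in triple i j k & x \in val p.
  move=> ac xac acE; exists (exist _ [set a; c] (pt _ _ ac)) => //.
  by rewrite inE.
rewrite in_setU in_set1; case/orP=> [xij | /eqP xk].
  by apply: (memb i j) => //; rewrite mem_head.
by apply: (memb j k) => //; rewrite ?xk ?set22 // !in_cons (eqxx [set j; k]) !orbT.
Qed.

Lemma n_neg1E (m : nat) (delta : decoration m) (i j k : 'I_m) (b : block m) :
  i != j -> i != k -> j != k -> val b = triple i j k ->
  n_neg1 delta b =
  #|[set r : 'I_m | (r \notin [set i; j; k]) &&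
      (dec_at delta i j k * dec_at delta i j r *
       dec_at delta i k r * dec_at delta j k r == -1)]|.
Proof.
move=> ij ik jk bE; rewrite /n_neg1 (supp_blockP ij ik jk bE).
apply: eq_card => r; rewrite !inE; congr (_ && _).
have d12 a c d : dec_at delta c a d = dec_at delta a c d.
  by rewrite /dec_at triple_perm12.
have d23 a c d : dec_at delta a d c = dec_at delta a c d.
  by rewrite /dec_at triple_perm23.
pose P a c d := dec_at delta a c d * dec_at delta a c r *
                dec_at delta a d r * dec_at delta c d r.
have P12 a c d : P c a d = P a c d.
  rewrite /P (d12 a c d) (d12 a c r).
  by move: (dec_at _ _ _ _ * _) => x; apply: mulrAC.
have P23 a c d : P a d c = P a c d.
  rewrite /P (d23 a c d) (d12 c d r).
  move: (dec_at _ a c d) (dec_at _ a c r) (dec_at _ a d r) => x y z.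
  by rewrite (mulrAC x z y).
apply/idP/idP; last first.
  move=> H; apply/existsP; exists i; apply/existsP; exists j.
  by apply/existsP; exists k; rewrite eqxx.
case/existsP=> a /existsP[c /existsP[d /andP[/eqP E]]].
change (P a c d == -1 -> P i j k == -1).
have c3 : #|[set i; j; k]| = 3.
  by rewrite setUC cardsU1 cards2 !inE ij negb_or ![k == _]eq_sym ik jk.
have ac : a != c.
  by apply/eqP=> X; move: c3; rewrite E X setUid cards2; case: eqP.
have ad : a != d.
  by apply/eqP=> X; move: c3; rewrite E X setUAC setUid cards2; case: eqP.
have cd : c != d.
  by apply/eqP=> X; move: c3; rewrite E X -setUA setUid cards2; case: eqP.
have aI : a \in [set i; j; k] by rewrite E !inE eqxx.
have cI : c \in [set i; j; k] by rewrite E !inE eqxx orbT.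
have dI : d \in [set i; j; k] by rewrite E !inE eqxx orbT.
clearbody P; suff -> : P a c d = P i j k by [].
move: aI cI dI ac ad cd; rewrite !inE -!orbA.
by case/or3P=> /eqP-> /or3P[] /eqP-> /or3P[] /eqP->; rewrite ?eqxx //= => _ _ _;
  rewrite 1?(P23 i j k) 1?(P12 i j k) // ?(P12 i k j) ?(P12 j k i)
    ?(P23 i j k) ?(P23 j i k) ?(P12 i j k).
Qed.

(* Main.v *)
Require Import Defs.
From mathcomp Require Import all_boot all_order all_algebra.

(** On the four blocks spanned by i, j, k, r the star decoration takes the value
    -1 three times if the star centre w is one of i, j, k, r, and never
    otherwise.  Hence for a block b the count is m - 3 if w lies in supp b, and
    otherwise only r = w contributes, giving 1 < m - 3. *)

(** Distinct indices make [triple i j k] a genuine block, so the default value in [dec_at] never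
    arises. *)
Lemma dec_at_star (m : nat) (w i j k : 'I_m) :
  i != j -> i != k -> j != k ->
  dec_at (star_decoration w) i j k =
  (if w \in [set i; j; k] then -1 else 1)%R.
Proof.
move=> ij ik jk; pose b : block m := Sub _ (triple_is_block ij ik jk).
have bE : val b = triple i j k by [].
by rewrite (dec_at_block _ bE) /= (supp_blockP ij ik jk bE).
Qed.

Lemma star_product (m : nat) (w i j k r : 'I_m) :
  i != j -> i != k -> j != k -> r \notin [set i; j; k] ->
  (dec_at (star_decoration w) i j k * dec_at (star_decoration w) i j r *
   dec_at (star_decoration w) i k r * dec_at (star_decoration w) j k r == -1)%R
  = (w \in [set i; j; k]) || (w == r).
Proof.
move=> ij ik jk; rewrite !inE !negb_or -andbA ![r == _]eq_sym => /and3P[ir jr kr].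
rewrite !dec_at_star // !inE.
have [->|_] := eqVneq w i.
  by rewrite (negPf ij) (negPf ik) (negPf ir).
have [->|_] := eqVneq w j; first by rewrite (negPf jk) (negPf jr).
have [->|_] := eqVneq w k; first by rewrite (negPf kr).
by case: (w == r).
Qed.

Lemma n_neg1_star (m : nat) (w : 'I_m) (b : block m) :
  n_neg1 (star_decoration w) b = if w \in supp b then m - 3 else 1.
Proof.
have /existsP[i /existsP[j /existsP[k /and4P[ij ik jk /eqP bE]]]] := valP b.
rewrite (n_neg1E _ ij ik jk bE) (supp_blockP ij ik jk bE).
(* [star_product] needs [r] outside the support; the left conjunct supplies this as [rS]. *)
under eq_finset => r.
  under andb_id2l => rS do rewrite (star_product _ w _ _ _ _ ij ik jk rS).
  over.
case: ifP => wS.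
  have -> : [set r | (r \notin [set i; j; k]) && (true || (w == r))] =
            ~: [set i; j; k] by apply/setP=> r; rewrite !inE andbT.
  rewrite cardsCs setCK card_ord setUC cardsU1 cards2 ij !inE negb_or.
  by rewrite ![k == _]eq_sym ik jk.
(* Here the counted set is the singleton of [w]. *)
rewrite -[RHS](cards1 w); apply: eq_card => r; rewrite [LHS]in_set in_set1 /= eq_sym.
by have [->|_] := eqVneq r w; rewrite ?andbF // wS.
Qed.

Theorem proposition4p3 (m : nat) (hm : (5 <= m)%N) (w : 'I_m) :
  Ax (star_decoration w) = St w.
Proof.
apply/setP=> b; rewrite !inE n_neg1_star.
(* Off the star, equality would force [1 = m - 3], that is [m = 4], which [hm] excludes. *)
by case: ifP => _; [rewrite eqxx | case: m hm {w b} => [|[|[|[|[|]]]]]].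
Qed.
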